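(* Let $s\ge 1$ be a fixed integer. Let $\mathcal{F}$ be a family of subsets of $[n]$ that contains no $s+1$ different sets $B,C_1,\dots,C_s$ such that $B\subset C_i$ for all $1\le i\le s$ and $|C_1|=|C_2|=\dots=|C_s|$. Then $$|\mathcal{F}|\le \left(1+\frac{2(s-1)}{n}+O\left(\frac{\sqrt{\log n}}{n^{3/2}}\right)\right)\binom{n}{\lfloor\frac{n}{2}\rfloor},$$ where the implied constant in the $O(\cdot)$ term does not depend on $n$ (as $n\to\infty$).
   Context: $[n]=\{1,2,\dots,n\}$. *)

(* Defs.v *)
From mathcomp Require Import all_boot.

Set Implicit Arguments.
Unset Strict Implicit.
Unset Printing Implicit Defensive.

(* The ground set [n] is rendered as 'I_n = {0, ..., n-1}. *)
Definition contains_level_fork (s n : nat) (F : {set {set 'I_n}}) : Prop :=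
  exists (B : {set 'I_n}) (C : s.-tuple {set 'I_n}),
    [/\ uniq (B :: C),
        {subset B :: C <= F},
        {in C, forall X : {set 'I_n}, B \subset X}
      & {in C &, forall X Y : {set 'I_n}, #|X| = #|Y|}].

(* Main.v *)
(* The weights 1 / 'C(n - |A|, |B| - |A|) are the probabilities that a uniformly
   random maximal chain through A also passes through B. For a family F, the
   number X of members met by a random maximal chain satisfies
   X - 'C(X, 2) <= 1. If F has no level fork, a given B in F has at most s - 1
   supersets in F on each higher level, so in expectation X is followed above B
   by at most (s - 1)(1/m + O(1/m^2)) further members, m = n - |B|, provided that
   all members stay at distance of order n from the top. Taking expectations
   gives the bound once the sets of size above n/2 + 4 sqrt(n ln n) are
   discarded; by an exponential moment estimate these are at most 2^n / n^4 many. *)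
Require Import Defs.
From mathcomp Require Import all_boot all_order all_algebra.
From mathcomp Require Import all_classical all_reals all_analysis.
From mathcomp Require Import ring lra zify.

Set Implicit Arguments.
Unset Strict Implicit.
Unset Printing Implicit Defensive.

Import Order.TTheory GRing.Theory Num.Theory.
Import numFieldNormedType.Exports.

Local Open Scope ring_scope.

(** * Expectations along random maximal chains *)

(** The expected total of [h] over the members from [A] upwards, [A] included, of a uniformly random
    maximal chain through [A]. *)
Definition chain_sum (R : realFieldType) (T : finType) (h : {set T} -> R) (A : {set T}) : R :=
  \sum_(B : {set T} | A \subset B) h B / ('C(#|T| - #|A|, #|B| - #|A|))%:R.

Lemma ler_chain_sum (R : realFieldType) (T : finType) (f g : {set T} -> R) (A : {set T}) :
  (forall B, f B <= g B) -> chain_sum f A <= chain_sum g A.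
Proof. by move=> le_fg; apply: ler_sum => B _; rewrite ler_wpM2r ?invr_ge0. Qed.

(** Condition on the element [x] that the chain adds right after [A]; it is uniform among the
    elements outside [A]. *)
Lemma chain_sum_step (R : realFieldType) (T : finType) (h : {set T} -> R) (A : {set T}) :
  (#|A| < #|T|)%N ->
  chain_sum h A = h A + (\sum_(x | x \notin A) chain_sum h (x |: A)) / (#|T| - #|A|)%:R.
Proof.
move=> ltAT; set m := (#|T| - #|A|)%N.
have m_gt0 : (0 < m)%N by rewrite subn_gt0.
rewrite /chain_sum (bigD1 A) //= subnn bin0 divr1; congr (_ + _).
rewrite (exchange_big_dep (fun B : {set T} => (A \subset B) && (B != A))) /=; last first.
  move=> x B xA /fintype.subsetP sxAB; apply/andP; split.
    by apply/fintype.subsetP => y yA; apply: sxAB; rewrite !inE yA orbT.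
  by apply: contraNneq xA => <-; apply: sxAB; rewrite !inE eqxx.
rewrite mulr_suml; apply: eq_bigr => B /andP[sAB neBA].
have ltAB : (#|A| < #|B|)%N by rewrite proper_card // finset.properEneq eq_sym neBA.
have leBT : (#|B| <= #|T|)%N by apply: max_card.
rewrite (eq_bigr (fun=> h B / ('C(m.-1, (#|B| - #|A|).-1))%:R)); last first.
  by move=> x /andP[xA _]; rewrite cardsU1 xA add1n !subnS.
rewrite sumr_const.
have -> : #|[pred x | (x \notin A) && (x |: A \subset B)]| = (#|B| - #|A|)%N.
  rewrite -(cardsDS sAB); apply: eq_card => x.
  by rewrite !inE finset.subUset finset.sub1set sAB andbT.
set k := (#|B| - #|A|)%N; have k_gt0 : (0 < k)%N by rewrite subn_gt0.
have lekm : (k <= m)%N by rewrite leq_sub2r.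
(* Each [B] strictly above [A] is reached through [k] choices of [x], so the weights agree by
   [k * 'C(m, k) = m * 'C(m.-1, k.-1)]. *)
have := mul_bin_diag m k.-1; rewrite prednK // => /(congr1 (fun i => i%:R : R)).
rewrite !natrM => E.
have c1 : ('C(m, k)%:R : R) != 0 by rewrite pnatr_eq0 -lt0n bin_gt0.
have c2 : ('C(m.-1, k.-1)%:R : R) != 0 by rewrite pnatr_eq0 -lt0n bin_gt0; lia.
have m0 : (m%:R : R) != 0 by rewrite pnatr_eq0 -lt0n.
rewrite -/m -/k -[X in _ = X / _]mulr_natr; move: E c1 c2 m0; clearbody k m.
move: ('C(m, k)%:R : R) ('C(m.-1, k.-1)%:R : R) (m%:R : R) (k%:R : R) => c c' a b E c1 c2 m0.
have -> : c' = b * c / a by rewrite -E mulrC mulKf.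
have b0 : b != 0.
  apply: contraNneq c2 => b0; move: E; rewrite b0 mul0r => /eqP.
  by rewrite mulf_eq0 (negPf m0).
by field; rewrite c1 m0 b0.
Qed.

(* If [A \in F], the later members of [F] already cancel the later terms. *)
Lemma chain_sum_le1 (R : realFieldType) (T : finType) (F : {set {set T}}) (A : {set T}) :
  chain_sum (fun B => (B \in F)%:R *
    (1 - (chain_sum (fun C => (C \in F)%:R) B - (B \in F)%:R)) : R) A <= 1.
Proof.
pose f (B : {set T}) : R := (B \in F)%:R.
rewrite -/f; set h : {set T} -> R := fun B => _.
have f_ge0 B : 0 <= f B by rewrite /f ler0n.
have f_le B : f B <= chain_sum f B.
  rewrite /chain_sum (bigD1 B) //= subnn bin0 divr1 lerDl.
  by apply: sumr_ge0 => C _; rewrite divr_ge0.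
have le_hf B : h B <= f B.
  by rewrite /h ler_piMr // lerBlDr lerDl subr_ge0; apply: f_le.
elim: {A}(#|T| - #|A|)%N {-2}A (erefl (#|T| - #|A|)%N) => [|m IH] A defm.
  have AT : A = [set: T].
    by apply/eqP; rewrite eqEcard finset.subsetT cardsT -subn_eq0 defm.
  rewrite /chain_sum AT (eq_bigl (pred1 [set: T])) => [|B]; last by rewrite /= finset.subTset.
  rewrite big_pred1_eq.
  rewrite subnn bin0 divr1 (le_trans (le_hf _)) // /f.
  by case: (_ \in _); rewrite ?ler01.
have ltAT : (#|A| < #|T|)%N by lia.
have card_out : (\sum_(x | x \notin A) (1 : R)) = (#|T| - #|A|)%:R.
  rewrite sumr_const -cardsT -(cardsDS (finset.subsetT A)); congr _%:R.
  by apply: eq_card => x; rewrite !inE andbT.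
have m_gt0 : 0 < (#|T| - #|A|)%:R :> R by rewrite ltr0n subn_gt0.
rewrite chain_sum_step // {1}/h; case: (boolP (A \in F)) => AF; last first.
  (* Here [A] contributes nothing, and an average of values at most 1 is at most 1. *)
  rewrite mul0r add0r ler_pdivrMr // mul1r -card_out.
  apply: ler_sum => x xA; apply: IH; rewrite cardsU1 xA; lia.
rewrite mul1r [chain_sum f A]chain_sum_step // {1}/f AF [X in 1 - X]addrC addKr.
rewrite -addrA gerDl addrC subr_le0 ler_pM2r ?invr_gt0 //.
by apply: ler_sum => x _; apply: ler_chain_sum.
Qed.

(** * The middle binomial coefficient *)

Lemma bin_le_half (n k : nat) : ('C(n, k) <= 'C(n, n %/ 2))%N.
Proof.
have mono i j : (i <= j)%N -> (j <= n %/ 2)%N -> ('C(n, i) <= 'C(n, j))%N.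
  move=> leij; rewrite -(subnKC leij); elim: (j - i)%N => [|d IH] led; first by rewrite addn0.
  apply: leq_trans (IH _) _; first by lia.
  have := mul_bin_left n (i + d); rewrite addnS => E.
  rewrite -(leq_pmul2l (ltn0Sn (i + d))) E leq_mul2r; apply/orP; right; lia.
case: (leqP k (n %/ 2)) => [lek|ltk]; first exact: mono.
case: (leqP k n) => [lekn|ltnk]; last by rewrite bin_small.
rewrite -bin_sub //; apply: mono; lia.
Qed.

Lemma exp2_le_bin_half (n : nat) : (2 ^ n <= n.+1 * 'C(n, n %/ 2))%N.
Proof.
have -> : (2 ^ n = \sum_(i < n.+1) 'C(n, i))%N.
  by rewrite -[2%N]/(1 + 1)%N expnDn; apply: eq_bigr => i _; rewrite !exp1n !muln1.
by rewrite -[X in (X * _)%N]card_ord -sum_nat_const; apply: leq_sum => i _; apply: bin_le_half.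
Qed.

(** * Fork-free families that stay away from the top level *)

(** Any [s] of the counted sets would form a level fork with [B]; [#|B| < k] makes them different
    from [B]. *)
Lemma level_fork_card (s n : nat) (F : {set {set 'I_n}}) (B : {set 'I_n}) (k : nat) :
  ~ contains_level_fork s F -> B \in F -> (#|B| < k)%N ->
  (#|[set C in F | (B \subset C) && (#|C| == k)]| < s)%N.
Proof.
move=> noF BF ltBk; set X := [set _ in _ | _]; rewrite ltnNge; apply/negP => les.
have sz : size (take s (enum X)) == s by rewrite size_takel // -cardE.
apply: noF; exists B, (Tuple sz).
have inX C : C \in Tuple sz -> [/\ C \in F, B \subset C & #|C| = k].
  by move/mem_take; rewrite mem_enum inE => /and3P[? ? /eqP].
split.
- rewrite cons_uniq take_uniq ?enum_uniq // andbT.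
  by apply/negP => /inX[_ _ eqk]; rewrite eqk ltnn in ltBk.
- by move=> C; rewrite inE => /orP[/eqP->|/inX[]].
- by move=> C /inX[].
- by move=> C D /inX[_ _ ->] /inX[_ _ ->].
Qed.

Lemma sum_ord_eq_le1 (R : realFieldType) (m c : nat) :
  \sum_(i < m) ((i == c :> nat)%:R : R) <= 1.
Proof.
case: (ltnP c m) => [ltcm|lemc].
  rewrite (bigD1 (Ordinal ltcm)) //= eqxx big1 ?addr0 // => i.
  by rewrite -val_eqE /= => /negPf ->.
rewrite big1 ?ler01 // => i _; case: eqP => // eq_ic.
by move: (ltn_ord i); rewrite eq_ic ltnNge lemc.
Qed.

(** Used with [p = n - #|C|] and [j = #|C| - #|B|]. Only the levels [j = 1] and [j = 2] need their
    own order in [mu]: the cubic term, even when summed over all [n.+1] levels, is still of order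
    [1 / mu ^+ 2] when [mu] is of order [n]. *)
Lemma inv_bin_le (R : realFieldType) (mu : R) (p j : nat) :
  0 < mu -> mu <= p%:R -> (0 < j)%N ->
  ('C(p + j, j)%:R)^-1 <= (j == 1%N)%:R / mu + (j == 2%N)%:R * 2 / mu ^+ 2 + 6 / mu ^+ 3.
Proof.
move=> mu0 lemu j0.
have i1 : 0 <= mu^-1 by rewrite invr_ge0 ltW.
have i2 : 0 <= 2 / mu ^+ 2 by rewrite divr_ge0 ?exprn_ge0 // ltW.
have i3 : 0 <= 6 / mu ^+ 3 by rewrite divr_ge0 ?exprn_ge0 // ltW.
case: j j0 => [|[|[|j]]] // _.
- rewrite /= bin1 mul0r mul0r addr0 mul1r -[leLHS]addr0 lerD //.
  by rewrite lef_pV2 ?posrE // ?natrD; lra.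
- rewrite /= mul0r add0r mul1r -[leLHS]addr0 lerD // -[leRHS]invf_div lef_pV2 ?posrE.
  + have E : ('C(p + 2, 2) * 2 = (p + 2) * (p + 1))%N.
      by rewrite -[X in (_ * X)%N]/2`! bin_ffact !ffactnS ffactn0; lia.
    by rewrite ler_pdivrMr // -natrM E natrM !natrD; nra.
  + by rewrite ltr0n bin_gt0 leq_addl.
  + by rewrite divr_gt0 ?exprn_gt0.
- rewrite /= !mul0r !add0r -[leRHS]invf_div lef_pV2 ?posrE.
  (* For fixed [p], ['C(p + j, j) = 'C(p + j, p)] grows with [j], so 3 is the worst case. *)
  + apply: le_trans (_ : ('C(p + 3, 3)%:R : R) <= _).
      have E : ('C(p + 3, 3) * 6 = (p + 3) * ((p + 2) * (p + 1)))%N.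
        by rewrite -[X in (_ * X)%N]/3`! bin_ffact !ffactnS ffactn0; lia.
      rewrite ler_pdivrMr // -natrM E !natrM !natrD.
      rewrite !exprS expr0 mulr1.
      by do 2 (apply: ler_pM; rewrite ?mulr_ge0 ?(ltW mu0) //; try lra).
    rewrite ler_nat -bin_sub ?leq_addl // addnK.
    rewrite -[leqRHS]bin_sub ?leq_addl // addnK leq_bin2l //; lia.
  + by rewrite ltr0n bin_gt0 leq_addl.
  + by rewrite divr_gt0 ?exprn_gt0.
Qed.

Lemma fork_free_chain_sum (R : realFieldType) (s n : nat) (F : {set {set 'I_n}})
    (mu : R) (B : {set 'I_n}) :
  (0 < s)%N -> 0 < mu ->
  {in F, forall C : {set 'I_n}, mu <= (n - #|C|)%:R} -> ~ contains_level_fork s F -> B \in F ->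
  chain_sum (fun C => (C \in F)%:R) B - (B \in F)%:R <=
    (s%:R - 1) * (1 / mu + 2 / mu ^+ 2 + 6 * n.+1%:R / mu ^+ 3) :> R.
Proof.
move=> s_gt0 mu0 hF noF BF; set b := #|B|.
(* [phi] bounds the weight of [C] by a function of [#|C|] alone, so that the sum can be grouped by
   levels, each above [B] holding at most [s - 1] sets. *)
pose phi (j : nat) : R := (j == b.+1)%:R / mu + (j == b.+2)%:R * 2 / mu ^+ 2 + 6 / mu ^+ 3.
have phi_ge0 j : 0 <= phi j.
  by rewrite /phi !addr_ge0 // ?divr_ge0 ?mulr_ge0 ?exprn_ge0 // ltW.
rewrite /chain_sum (bigD1 B) //= subnn bin0 divr1 [X in X - _]addrC addrK.
apply: (@le_trans _ _ (\sum_(C | [&& C \in F, B \subset C & (b < #|C|)%N]) phi #|C|)).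
  rewrite big_mkcond [leRHS]big_mkcond; apply: ler_sum => C _.
  case: (boolP (C \in F)) => CF /=; last by case: ifP; rewrite ?mul0r.
  case: (boolP (B \subset C)) => sBC //=.
  case: (eqVneq C B) => [->|neCB] /=; first by rewrite ltnn.
  have ltBC : (b < #|C|)%N by rewrite proper_card // finset.properEneq eq_sym neCB.
  have leCn : (#|C| <= n)%N by rewrite -[leqRHS]card_ord max_card.
  rewrite ltBC mul1r card_ord (_ : (n - b = (n - #|C|) + (#|C| - b))%N); last by lia.
  have := @inv_bin_le R mu (n - #|C|) (#|C| - b) mu0 (hF _ CF).
  rewrite subn_gt0 => /(_ ltBC); rewrite /phi.
  have eqS j : (#|C| - b == j)%N = (#|C| == b + j)%N.
    by rewrite -(eqn_add2l b) subnKC // ltnW.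
  by rewrite !eqS addn1 addn2.
have ltn1 (C : {set 'I_n}) : (#|C| < n.+1)%N by rewrite ltnS -[leqRHS]card_ord max_card.
rewrite (partition_big (fun C : {set 'I_n} => Ordinal (ltn1 C)) xpredT) //=.
apply: (@le_trans _ _ (\sum_(k < n.+1) (s%:R - 1) * phi k)); last first.
  rewrite -mulr_sumr ler_wpM2l ?subr_ge0 ?ler1n // /phi !big_split /= !lerD //.
  - by rewrite -mulr_suml ler_pM2r ?invr_gt0 // sum_ord_eq_le1.
  - rewrite -mulr_suml ler_pM2r ?invr_gt0 ?exprn_gt0 //.
    by rewrite -mulr_suml -[leRHS]mul1r ler_pM2r ?sum_ord_eq_le1.
  - by rewrite sumr_const card_ord -[_ *+ n.+1]mulr_natr mulrAC.
apply: ler_sum => k _; case: (ltnP b k) => [ltbk|lekb]; last first.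
  rewrite big1 ?mulr_ge0 ?subr_ge0 ?ler1n // => C /andP[/and3P[_ _ lt1] /eqP/(congr1 val) /= eqk].
  by move: lt1; rewrite eqk ltnNge lekb.
rewrite (eq_bigr (fun=> phi k)) => [|C /andP[_ /eqP <-]] //.
rewrite sumr_const -[phi k *+ _]mulr_natl ler_wpM2r //.
rewrite lerBrDr natr1 ler_nat; apply: leq_trans (level_fork_card noF BF ltbk).
rewrite ltnS; apply: subset_leq_card; apply/fintype.subsetP => C.
by rewrite !inE => /andP[/and3P[-> -> _] /eqP <-] /=.
Qed.

Lemma fork_free_card (R : realFieldType) (s n : nat) (F : {set {set 'I_n}}) (mu d : R) :
  (0 < s)%N -> 0 < mu ->
  {in F, forall C : {set 'I_n}, mu <= (n - #|C|)%:R} -> ~ contains_level_fork s F ->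
  d = (s%:R - 1) * (1 / mu + 2 / mu ^+ 2 + 6 * n.+1%:R / mu ^+ 3) -> d <= 1 ->
  (1 - d) * #|F|%:R <= 'C(n, n %/ 2)%:R.
Proof.
move=> s_gt0 mu0 hF noF defd led.
have c_gt0 : 0 < ('C(n, n %/ 2)%:R : R) by rewrite ltr0n bin_gt0 leq_div.
rewrite -[leRHS]mul1r -ler_pdivrMr //.
(* Started at the empty set, the chain sum gives each [B] in [F] the weight [1 / 'C(n, #|B|)], as in
   the LYM inequality, times a factor of at least [1 - d]. *)
apply: le_trans (@chain_sum_le1 R _ F finset.set0).
rewrite {1}/chain_sum cards0 subn0 card_ord (eq_bigl xpredT) => [|B];
  last by rewrite finset.sub0set.
rewrite -sum1_card natr_sum big_mkcond /= mulr_sumr mulr_suml; apply: ler_sum => B _.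
rewrite subn0; case: (boolP (B \in F)) => BF; last by rewrite mulr0 !mul0r.
have d_bound := fork_free_chain_sum s_gt0 mu0 hF noF BF.
rewrite mulr1 mul1r; apply: ler_pM; rewrite ?subr_ge0 ?invr_ge0 //.
  by move: d_bound; rewrite BF -defd lerD2l lerN2.
rewrite lef_pV2 ?posrE // ?ler_nat ?bin_le_half // ltr0n bin_gt0.
by rewrite -[leqRHS]card_ord max_card.
Qed.

Lemma contains_level_fork_sub (s n : nat) (F G : {set {set 'I_n}}) :
  G \subset F -> contains_level_fork s G -> contains_level_fork s F.
Proof.
move=> /fintype.subsetP sGF [B [C [uBC CG BC cC]]]; exists B, C; split=> //.
by move=> X /CG /sGF.
Qed.

(** * Exponential moments and the number of large sets *)

(** This bounds the moment generating function of a fair 0/1 variable. It follows from [expR l <= 1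
    / (1 - l) <= 1 + l + 2 * l ^+ 2] on this range and [1 + x <= expR x]. *)
Lemma expR1D_half_le (R : realType) (l : R) : 0 <= l <= 1 / 2 ->
  1 + expR l <= 2 * expR (l / 2 + l ^+ 2).
Proof.
move=> /andP[l0 l1]; have e_le : expR l <= 1 + l + 2 * l ^+ 2.
  have := @expR_ge1Dx R (- l); rewrite expRN => h.
  have e0 := expR_gt0 l.
  have {}h : (1 - l) * expR l <= 1 by rewrite -ler_pdivlMr // mul1r.
  have l2 : 0 <= l ^+ 2 by rewrite exprn_ge0.
  rewrite -(@ler_pM2l _ (1 - l)); last lra.
  by apply: le_trans h _; rewrite expr2 in l2 *; nra.
have := @expR_ge1Dx R (l / 2 + l ^+ 2); lra.
Qed.

(* Markov's inequality for [expR (l * #|A|)] with [A] uniform. *)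
Lemma upper_tail_card (R : realType) (n : nat) (F : {set {set 'I_n}}) (l t : R) :
  0 <= l <= 1 / 2 -> {in F, forall A : {set 'I_n}, n%:R / 2 + t <= #|A|%:R} ->
  #|F|%:R <= 2 ^+ n * expR (n%:R * l ^+ 2 - l * t).
Proof.
move=> hl hF; have /andP[l0 _] := hl.
(* The moment factorizes: each of the [n] elements independently lies in [A] or not. *)
have sumE : \sum_(A : {set 'I_n}) expR l ^+ #|A| = (expR l + 1) ^+ n.
  rewrite -[in RHS](card_ord n) -prodr_const bigA_distr; apply: eq_bigr => A _.
  by rewrite -big_mkcond /= prodr_const.
rewrite -sum1_card natr_sum.
apply: (@le_trans _ _ (\sum_(A : {set 'I_n}) expR l ^+ #|A| * expR (- l * (n%:R / 2 + t)))).
  rewrite big_mkcond; apply: ler_sum => A _; case: ifP => [AF|_].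
    rewrite -expRM_natr -expRD -[leLHS]expR0 ler_expR.
    by have := hF _ AF; rewrite mulNr -mulrBr => h; rewrite mulr_ge0 ?subr_ge0.
  by rewrite mulr_ge0 ?exprn_ge0 ?expR_ge0.
rewrite -mulr_suml sumE.
have -> : n%:R * l ^+ 2 - l * t = (l / 2 + l ^+ 2) * n%:R + (- l * (n%:R / 2 + t)).
  by field.
rewrite expRD mulrA ler_pM2r ?expR_gt0 // expRM_natr -exprMn.
by rewrite lerXn2r ?nnegrE ?mulr_ge0 ?addr_ge0 ?expR_ge0 // addrC expR1D_half_le.
Qed.

(** * Numerical estimates for the error term *)

(** Rests on [(1 - D) * (1 + D + 2 * D ^+ 2) = 1 + D ^+ 2 * (1 - 2 * D) >= 1]. *)
Lemma le_of_mul_1B_le (R : realFieldType) (D x c : R) :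
  0 <= D -> D <= 1 / 2 -> 0 <= c -> (1 - D) * x <= c -> x <= (1 + D + 2 * D ^+ 2) * c.
Proof.
move=> D0 D1 c0 x_le; rewrite -(@ler_pM2l _ (1 - D)); last lra.
by apply: le_trans x_le _; rewrite mulrA ler_peMl //; nra.
Qed.

(** Meant for [N = n], [S = s - 1] and [u = sqrt (ln N / N)], so that [u / N] is the order of the
    error and [mu] the distance to the top that is left after truncation. *)
Lemma density_bound (R : realFieldType) (N u S d x c : R) :
  let mu := N * (1 / 2 - 4 * u) in
  512 ^+ 2 <= N -> 1 / N <= u -> u <= 1 / 16 -> 0 <= S -> 120 * (S + 1) <= N ->
  d = S * (1 / mu + 2 / mu ^+ 2 + 6 * (N + 1) / mu ^+ 3) -> 0 <= c ->
  d <= 1 /\ ((1 - d) * x <= c ->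
    x <= (1 + 2 * S / N + (832 * S + 2 * (54 * S) ^+ 2) * (u / N)) * c).
Proof.
move=> mu N0 u0 u1 S0 SN defd c0.
have Npos : 0 < N by lra.
pose v := 1 / N; have v0 : 0 < v by rewrite divr_gt0.
have Nv : N * v = 1 by rewrite /v mul1r divff ?gt_eqF.
have vE : v = 1 / N by [].
clearbody v; rewrite -vE in u0.
have mu0 : 0 < mu by rewrite mulr_gt0 //; lra.
have i1 : 1 / mu <= 2 * v * (1 + 16 * u).
  rewrite ler_pdivrMr //.
  have -> : 2 * v * (1 + 16 * u) * mu = (N * v) * ((1 + 16 * u) * (1 - 8 * u)).
    by rewrite /mu; field.
  (* [(1 + 16 * u) * (1 - 8 * u) = 1 + 8 * u * (1 - 16 * u) >= 1], as [u <= 1 / 16]. *)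
  by rewrite Nv mul1r; nra.
clearbody mu.
have i1' : 1 / mu <= 4 * v by apply: le_trans i1 _; nra.
have imu0 : 0 <= 1 / mu by rewrite divr_ge0 ?ltW.
have sq : (1 / mu) ^+ 2 <= (4 * v) ^+ 2 by rewrite ler_pXn2r ?nnegrE //; lra.
have cu : (1 / mu) ^+ 3 <= (4 * v) ^+ 3 by rewrite ler_pXn2r ?nnegrE //; lra.
rewrite !mul1r !exprVn in sq cu.
have i3 : 6 * (N + 1) / mu ^+ 3 <= 768 * v ^+ 2.
  apply: (@le_trans _ _ (6 * (N + 1) * (4 * v) ^+ 3)); first by rewrite ler_pM2l //; lra.
  have -> : 6 * (N + 1) * (4 * v) ^+ 3 = 384 * v ^+ 2 * (N * v + v) by ring.
  have v1 : v <= 1 by rewrite -[leRHS]Nv ler_peMl ?(ltW v0) //; lra.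
  have h : 0 <= v ^+ 2 * (1 - v) by rewrite mulr_ge0 ?exprn_ge0 ?subr_ge0 // ltW.
  rewrite Nv; lra.
(* The three terms of [d / S] are at most [2 * v + 32 * u * v], [32 * v ^+ 2] and [768 * v ^+ 2];
   with [v ^+ 2 <= u * v] this gives [832 = 32 + 32 + 768]. *)
pose D := S * v * (2 + 832 * u).
have vu : v ^+ 2 <= u * v by rewrite expr2 ler_pM2r.
have dD : d <= D.
  rewrite defd /D -[S * v * _]mulrA ler_wpM2l //.
  by have := ler_wpM2l (ler0n R 2) sq; lra.
(* [54 = 2 + 832 / 16]; the factor 120 in the hypothesis then makes [D <= 54 / 120 < 1 / 2]. *)
have D54 : D <= 54 * S * v.
  rewrite /D [54 * S]mulrC -!mulrA ler_wpM2l // mulrC ler_pM2r //; lra.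
have Sv : 120 * (S * v) <= 1.
  by rewrite -[leRHS]Nv mulrA ler_pM2r //; lra.
have D0 : 0 <= D by apply: mulr_ge0; [exact: mulr_ge0 S0 (ltW v0) | lra].
have D12 : D <= 1 / 2 by lra.
split=> [|hx]; first lra.
have x_le : (1 - D) * x <= c.
  case: (leP 0 x) => x0; first by apply: le_trans hx; rewrite ler_wpM2r // lerD2l lerN2.
  by apply: le_trans c0; rewrite mulr_ge0_le0 ?(ltW x0) // subr_ge0 (le_trans D12) //; lra.
have x_le2 := le_of_mul_1B_le D0 D12 c0 x_le.
apply: le_trans x_le2 _; rewrite ler_wpM2r // -[1 + _ + _ in leRHS]addrA -[leLHS]addrA lerD2l.
have -> : 2 * S / N + (832 * S + 2 * (54 * S) ^+ 2) * (u / N) = D + 2 * (54 * S) ^+ 2 * (u * v).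
  by rewrite /D vE; field; rewrite gt_eqF.
rewrite lerD2l.
apply: (@le_trans _ _ (2 * (54 * S * v) ^+ 2)).
  by rewrite ler_pM2l // ler_pXn2r ?nnegrE // !mulr_ge0 // ltW.
have -> : 2 * (54 * S * v) ^+ 2 = 2 * (54 * S) ^+ 2 * v ^+ 2 by ring.
by rewrite ler_wpM2l // mulr_ge0 // sqr_ge0.
Qed.

(** The upper bound applies [ln x < x] to [x = sqrt N]: [u ^+ 2 <= 2 / sqrt N <= 2 / 512 = (1 / 16)
    ^+ 2], whence the threshold [512 ^+ 2]. The lower bound only needs
    [ln N >= 1 - 1 / N >= 1 / N]. *)
Lemma ln_sqrt_bounds (R : realType) (N : R) : 512 ^+ 2 <= N ->
  let u := Num.sqrt (ln N) / Num.sqrt N in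
  [/\ u ^+ 2 = ln N / N, 1 / N <= u & u <= 1 / 16].
Proof.
move=> N0 u; have Npos : 0 < N by lra.
have s0 : 0 < Num.sqrt N by rewrite sqrtr_gt0.
have sN : Num.sqrt N ^+ 2 = N by rewrite sqr_sqrtr // ltW.
have s512 : 512 <= Num.sqrt N by rewrite -(@ler_pXn2r _ 2) ?nnegrE ?ler0n ?(ltW s0) ?sN.
have L_le : ln N <= 2 * Num.sqrt N.
  have := ln_sublinear s0; rewrite -[in ln N]sN lnXn // -mulr_natl; lra.
have L_ge : 1 - 1 / N <= ln N.
  have i0 : 0 < 1 / N by rewrite divr_gt0.
  have := @le_ln1Dx R (1 / N - 1); rewrite [1 + _]addrC subrK div1r lnV ?posrE //.
  rewrite div1r in i0; lra.
have Ni : 1 / N <= 1 / 2 by rewrite ler_pdivrMr //; lra.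
have L0 : 0 <= ln N by lra.
have u2 : u ^+ 2 = ln N / N by rewrite /u expr_div_n sqr_sqrtr // sN.
have u0 : 0 <= u by rewrite /u divr_ge0 // ltW.
have Ni0 : 0 < 1 / N by rewrite divr_gt0.
split=> //.
  rewrite -(@ler_pXn2r _ 2) ?nnegrE ?(ltW Ni0) // u2 expr2.
  by rewrite -[N^-1 in leRHS]div1r ler_pM2r //; lra.
rewrite -(@ler_pXn2r _ 2) ?nnegrE // ?divr_ge0 // u2 ler_pdivrMr //.
have : 512 * Num.sqrt N <= N by rewrite -[leRHS]sN expr2 ler_pM2r.
lra.
Qed.

(** * Truncation and the asymptotic bound *)

Lemma fork_free_bound (R : realType) (s n : nat) (F : {set {set 'I_n}}) :
  (0 < s)%N -> 512 ^+ 2 <= n%:R :> R -> 120 * s%:R <= n%:R :> R ->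
  ~ contains_level_fork s F ->
  #|F|%:R <= (1 + 2 * (s%:R - 1) / n%:R +
    (832 * s%:R + 2 * (54 * s%:R) ^+ 2 + 2) * (Num.sqrt (ln (n%:R : R)) / n%:R `^ (3 / 2)))
    * ('C(n, n %/ 2))%:R.
Proof.
move=> s_gt0 N0 Ns noF; set N : R := n%:R.
set c : R := 'C(n, n %/ 2)%:R; have c0 : 0 <= c by rewrite ler0n.
have Npos : 0 < N by rewrite /N; lra.
have [] := ln_sqrt_bounds N0; rewrite -/N; set u := Num.sqrt (ln N) / Num.sqrt N => u2 u0 u1.
have upos : 0 < u by apply: lt_le_trans u0; rewrite divr_gt0.
have -> : Num.sqrt (ln N) / N `^ (3 / 2) = u / N.
  rewrite (_ : 3 / 2 = 1 + 2^-1); last by field.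
  rewrite powRD ?powRr1 ?powR12_sqrt ?(ltW Npos) //; last by rewrite gt_eqF ?implybT.
  by rewrite /u invfM mulrA mulrAC.
pose mu : R := N * (1 / 2 - 4 * u); have mu0 : 0 < mu by rewrite mulr_gt0 //; lra.
(* [F1] keeps the sets of size at most [n / 2 + 4 * N * u], where [N * u = sqrt (N * ln N)]. *)
pose F1 := [set A in F | mu <= (n - #|A|)%:R].
have noF1 : ~ contains_level_fork s F1.
  apply: contra_not noF; apply: contains_level_fork_sub.
  by apply/fintype.subsetP => A; rewrite inE => /andP[].
have hF1 : {in F1, forall C : {set 'I_n}, mu <= (n - #|C|)%:R}.
  by move=> C; rewrite inE => /andP[].
pose S : R := s%:R - 1; have S0 : 0 <= S by rewrite subr_ge0 ler1n.
pose d := S * (1 / mu + 2 / mu ^+ 2 + 6 * n.+1%:R / mu ^+ 3).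
have defd : d = S * (1 / mu + 2 / mu ^+ 2 + 6 * (N + 1) / mu ^+ 3) by rewrite /d -[n.+1%:R]natr1.
have SN : 120 * (S + 1) <= N by rewrite subrK.
have [d1 /(_ (fork_free_card s_gt0 mu0 hF1 noF1 erefl d1)) F1_le] :=
  @density_bound R N u S d #|F1|%:R c N0 u0 u1 S0 SN defd c0.
have F2_le : #|F :\: F1|%:R <= 2 * (u / N) * c.
  (* The tail bound is taken with [l = 2 * u] and [t = 4 * N * u]. The exponent becomes
     [- 4 * N * u ^+ 2 = - 4 * ln N], so at most [2 ^+ n / N ^+ 4] sets are lost. *)
  apply: (@le_trans _ _ (2 ^+ n * expR (N * (2 * u) ^+ 2 - 2 * u * (4 * N * u)))).
    apply: upper_tail_card; first by apply/andP; split; lra.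
    move=> A; rewrite !inE => /andP[+ AF]; rewrite AF /= -ltNge natrB; last first.
      by rewrite -[leqRHS]card_ord max_card.
    by rewrite /mu -/N; lra.
  have -> : N * (2 * u) ^+ 2 - 2 * u * (4 * N * u) = - (4%:R * ln N).
    have -> : ln N = N * u ^+ 2 by rewrite u2 mulrC divfK // gt_eqF.
    by ring.
  rewrite expRN expRM_natl lnK ?posrE // ler_pdivrMr ?exprn_gt0 //.
  (* Passing from [2 ^+ n] to the middle binomial costs a factor [N + 1], which the power [N ^+ 4]
     absorbs. The resulting [2 * (u / N)] is the final [+ 2] in the constant. *)
  have h2 : 2 ^+ n <= (N + 1) * c.
    by rewrite /N /c natr1 -natrM -natrX ler_nat exp2_le_bin_half.
  apply: le_trans h2 _.
  have -> : 2 * (u / N) * c * N ^+ 4 = 2 * u * N ^+ 3 * c by field; rewrite gt_eqF.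
  rewrite ler_wpM2r //.
  have uN : 1 <= u * N by rewrite -ler_pdivrMr.
  have -> : 2 * u * N ^+ 3 = 2 * N ^+ 2 * (u * N) by ring.
  apply: (@le_trans _ _ (2 * N ^+ 2)); last by rewrite ler_peMr // mulr_ge0 ?exprn_ge0 // ltW.
  by rewrite expr2; nra.
have cardF : #|F|%:R = #|F1|%:R + #|F :\: F1|%:R :> R.
  rewrite -natrD -(cardsID F1 F); congr (_ + _)%:R; apply: eq_card => A.
  by rewrite !inE; case: (A \in F).
rewrite cardF; apply: le_trans (lerD F1_le F2_le) _.
rewrite -mulrDl ler_wpM2r // -addrA lerD2l -mulrDl ler_wpM2r ?divr_ge0 ?(ltW upos) ?(ltW Npos) //.
have s1 : 1 <= s%:R :> R by rewrite ler1n.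
by rewrite lerD2r /S !expr2; nra.
Qed.

Local Open Scope classical_set_scope.

Theorem theorem2p7 (R : realType) (s : nat) (hs : (1 <= s)%N) :
  exists e : nat -> R,
    e =O_\oo (fun n : nat => Num.sqrt (ln (n%:R : R)) / (n%:R `^ (3 / 2))) /\
    forall (n : nat) (F : {set {set 'I_n}}),
      (0 < n)%N ->
      ~ contains_level_fork s F ->
      (#|F|%:R : R) <=
        (1 + 2 * (s%:R - 1) / n%:R + e n) * ('C(n, n %/ 2))%:R.
Proof.
pose K : R := 832 * s%:R + 2 * (54 * s%:R) ^+ 2 + 2.
have K0 : 0 < K.
  apply: ltr_wpDl; last by rewrite ltr0n.
  by apply: addr_ge0; apply: mulr_ge0; rewrite ?ler0n ?sqr_ge0.
pose g n : R := Num.sqrt (ln (n%:R : R)) / (n%:R `^ (3 / 2)).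
(* Below the thresholds the error is [2 ^+ n], which bounds [#|F|] trivially; these finitely many
   [n] do not affect the [O] estimate. *)
exists (fun n => if (512 ^+ 2 <= n%:R :> R) && (120 * s%:R <= n%:R :> R) then K * g n else 2 ^+ n).
split.
  apply/eqO_exP; exists K => //; near=> n.
  have -> : (512 ^+ 2 <= n%:R :> R) && (120 * s%:R <= n%:R :> R).
    by apply/andP; split; near: n; apply: nbhs_infty_ger.
  by rewrite normrM (gtr0_norm K0).
move=> n F n_gt0 noF; case: ifP => [/andP[N0 Ns]|_]; first exact: fork_free_bound.
have c1 : 1 <= 'C(n, n %/ 2)%:R :> R by rewrite ler1n bin_gt0 leq_div.
have s1 : 0 <= 2 * (s%:R - 1) / n%:R :> R by rewrite divr_ge0 // mulr_ge0 // subr_ge0 ler1n.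
have F_le : #|F|%:R <= 2 ^+ n :> R.
  rewrite -natrX ler_nat; apply: leq_trans (max_card _) _.
  by rewrite -cardsT -powersetT card_powerset cardsT card_ord.
apply: le_trans F_le _; have e0 : 0 <= 2 ^+ n :> R by rewrite exprn_ge0.
apply: le_trans (_ : 1 + 2 * (s%:R - 1) / n%:R + 2 ^+ n <= _); first lra.
by rewrite ler_peMr //; lra.
Unshelve. all: by end_near.
Qed.
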